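(* Let $\lambda\neq 0$, $a\ge 0$, $c\in\mathbb{R}$ with $a^2+c^2\neq 0$, and let $\Omega=[\omega^-,\omega^+]$ with $\omega^-<0<\omega^+$. Consider the control system on $\mathbb{R}^2$ $$\dot s=\omega,\qquad \dot t=\lambda t+\omega(c+as),\qquad \omega\in\Omega .$$ Then: (1) If $a=0$, the system admits a unique control set $\mathcal C$, its closure is $\mathbb{R}\times\left(-\frac{c}{\lambda}\Omega\right)$, and $\mathcal C$ is closed if $\lambda<0$ and open if $\lambda>0$. (2) If $a>0$ and $\lambda<0$, the system admits a unique control set $\mathcal C$, it is closed, and $\mathcal C=\mathbb{R}^2\setminus(\mathcal C^+\cup\mathcal C^-)$, where, with $F_\omega(s,t)=\lambda^2 t+\omega(\lambda(c+as)+a\omega)$, $\mathbf v_a=(-c/a,0)$ and $\varphi(\tau,\mathbf v_a,\omega)=\big(-\tfrac ca+\tau\omega,\ \tfrac{a\omega^2}{\lambda^2}(e^{\lambda\tau}-\lambda\tau-1)\big)$, $$\mathcal C^-=\{\mathbf v: F_{\omega^-}(\mathbf v)<0,\ F_{\omega^+}(\mathbf v)<0\},$$ $$\mathcal C^+=\{(s,t):\exists\tau\ge0,\ \exists\omega\in\{\omega^-,\omega^+\},\ s=\varphi_1(\tau,\mathbf v_a,\omega),\ t>\varphi_2(\tau,\mathbf v_a,\omega)\}.$$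
   Context: Controls are piecewise constant functions $\omega:\mathbb{R}\to\Omega$; $\varphi(\tau,\mathbf v,\omega)$ is the solution at time $\tau$ from $\mathbf v$, and $\mathcal O^+(\mathbf v)$ is the set of points reachable from $\mathbf v$ in nonnegative time. A control set is a nonempty set $\mathcal C\subset\mathbb{R}^2$, maximal with respect to inclusion, such that (i) for every $x\in\mathcal C$ there is a control $\omega$ with $\varphi(\tau,x,\omega)\in\mathcal C$ for all $\tau\ge0$, and (ii) $\mathcal C\subset\overline{\mathcal O^+(x)}$ for all $x\in\mathcal C$. This system is (up to a diffeomorphism) the singular linear control system with $\beta=0$, $\lambda+\beta\neq0$ on $(\mathbb{R}\mathbf e_1\times\{0\})\backslash\mathbb{H}\simeq\mathbb{R}^2$. *)

(* Defs.v *)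
From HB Require Import structures.
From mathcomp Require Import all_boot all_order all_algebra.
From mathcomp Require Import all_classical all_reals all_analysis.
Set Implicit Arguments. Unset Strict Implicit. Unset Printing Implicit Defensive.
Import Order.TTheory GRing.Theory Num.Theory.
Import numFieldNormedType.Exports.
Local Open Scope classical_set_scope.
Local Open Scope ring_scope.

Section Sys.
Variable R : realType.
Variables (lam a c wm wp : R).

Definition loc_const (w : R -> R) (tau : R) : Prop :=
  exists2 d : R, 0 < d & forall r, `|r - tau| < d -> w r = w tau.

Definition piecewise_constant (w : R -> R) : Prop :=
  forall lo hi : R, exists D : seq R,
    forall tau, lo <= tau <= hi -> tau \notin D -> loc_const w tau.

Definition admissible (w : R -> R) : Prop :=
  piecewise_constant w /\ forall tau, wm <= w tau <= wp.

(* x is the solution from v under control w of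
     s' = w,  t' = lam t + w (c + a s)   (Caratheodory sense: continuous,
   and satisfies the ODE wherever w is locally constant) *)
Definition is_solution (w : R -> R) (v : R * R) (x : R -> R * R) : Prop :=
  x 0 = v /\ continuous x /\
  forall tau, loc_const w tau ->
    is_derive tau (1:R) (fun r => (x r).1) (w tau) /\
    is_derive tau (1:R) (fun r => (x r).2)
              (lam * (x tau).2 + w tau * (c + a * (x tau).1)).

Definition orbit_plus (v : R * R) : set (R * R) :=
  [set y | exists w x tau, admissible w /\ is_solution w v x /\
                           0 <= tau /\ x tau = y].

Definition ctrl_invariant (C : set (R * R)) : Prop :=
  forall v, C v -> exists w x, admissible w /\ is_solution w v x /\
                               forall tau, 0 <= tau -> C (x tau).

Definition approx_ctrl (C : set (R * R)) : Prop :=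
  forall v, C v -> C `<=` closure (orbit_plus v).

Definition control_set (C : set (R * R)) : Prop :=
  C !=set0 /\ ctrl_invariant C /\ approx_ctrl C /\
  forall D : set (R * R), D !=set0 -> ctrl_invariant D -> approx_ctrl D ->
    C `<=` D -> D = C.

Definition Fw (w : R) (p : R * R) : R :=
  lam ^+ 2 * p.2 + w * (lam * (c + a * p.1) + a * w).

Definition Cminus : set (R * R) :=
  [set p | Fw wm p < 0 /\ Fw wp p < 0].

Definition Cplus : set (R * R) :=
  [set p | exists tau w, 0 <= tau /\ (w = wm \/ w = wp) /\
     p.1 = - c / a + tau * w /\
     a * w ^+ 2 / lam ^+ 2 * (expR (lam * tau) - lam * tau - 1) < p.2].
End Sys.

(* Main.v *)
Require Import Defs.
From HB Require Import structures.
From mathcomp Require Import all_boot all_order all_algebra.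
From mathcomp Require Import all_classical all_reals all_analysis.
From mathcomp Require Import ring lra.
Import Order.TTheory GRing.Theory Num.Theory.
Import numFieldNormedType.Exports.
Local Open Scope classical_set_scope.
Local Open Scope ring_scope.

(* Under a constant control u the quantity F_u evolves by F_u' = lambda F_u,
   which integrates the system; points reachable from v are the endpoints of
   finite concatenations of such arcs.  Any set satisfying (i) and (ii) is shown
   to lie in the candidate C, so C is maximal and unique as soon as it satisfies
   (i) and (ii) itself.

   Upper bound: for lambda < 0, a continuous G with
   G (flow u tau p) <= e^{lambda tau} G p is nonpositive on every recurrent set.
   For a = 0 take the signed distances of the level t / k, k = - c / lambda, to
   the ends of Omega; for a > 0 take t - top s, top being the graph of the
   extremal trajectories issued from v_a, and - max (F_{omega-}, F_{omega+}).
   For a = 0 and lambda > 0, t / k + lambda s is strictly monotone off the open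
   strip.

   Approximate controllability: for a = 0, steer to a positive or a negative
   equilibrium level and slide along it as long as needed.  For a > 0, go to the
   line s = - c / a and wait there with u = 0 to come close to v_a; from v_a
   follow the graph of top up to abscissa s - K w, then use the control w during
   time K.  The value of F_w at the endpoint, which has abscissa s, runs
   continuously from F_w (s, top s) at K = 0 towards 0 as K grows. *)

(** * Functions with zero derivative on an interval *)

Section Calculus.
Variable R : realType.
Implicit Types (f : R -> R) (x : R).

Lemma constant_itv f (lo hi : R) : lo <= hi ->
  (forall x, x \in `]lo, hi[ -> is_derive x 1 f 0) ->
  {within `[lo, hi], continuous f} -> f hi = f lo.
Proof.
move=> lohi df cf; have [x _] := MVT_segment lohi df cf.
by rewrite mul0r => /eqP; rewrite subr_eq0 => /eqP.
Qed.

Lemma is_derive_continuous f x df : is_derive x 1 f df -> {for x, continuous f}.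
Proof. by case=> + _ => /derivable1_diffP/differentiable_continuous. Qed.

End Calculus.

(** * Flow of a constant control; trajectories as concatenations of such arcs *)

Section Flow.
Variables (R : realType) (lam a c wm wp : R).
Hypothesis lam0 : lam != 0.
Local Notation F := (Fw lam a c).
Implicit Types (u tau sig : R) (p v y : R * R) (w : R -> R) (x : R -> R * R).

(* Along the constant control u one has (F u)' = lam * F u; the second component
   solves this for t. *)
Definition const_flow u tau p : R * R :=
  let s := p.1 + tau * u in
  (s, (expR (lam * tau) * F u p - u * (lam * (c + a * s) + a * u)) / lam ^+ 2).

Lemma Fw_flow u tau p : F u (const_flow u tau p) = expR (lam * tau) * F u p.
Proof. by rewrite /const_flow {1}/Fw /=; field. Qed.

Lemma flowP u tau p y :
  y.1 = p.1 + tau * u -> F u y = expR (lam * tau) * F u p -> y = const_flow u tau p.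
Proof.
case: y => s t /= -> H; rewrite /const_flow -H; congr pair.
by rewrite /Fw /=; field.
Qed.

Lemma flow0 u p : const_flow u 0 p = p.
Proof. by apply/esym/flowP; rewrite ?mul0r ?addr0 // mulr0 expR0 mul1r. Qed.

Lemma flowD u sig tau p : const_flow u (sig + tau) p = const_flow u tau (const_flow u sig p).
Proof.
apply/esym/flowP; first by rewrite /=; ring.
by rewrite !Fw_flow (mulrDr lam) expRD; ring.
Qed.

Lemma is_derive_flow1 u (r0 : R) p (r : R) :
  is_derive r (1 : R) (fun z => (const_flow u (z - r0) p).1) u.
Proof.
rewrite /const_flow /=; apply: is_derive_eq.
by rewrite /GRing.scale /=; ring.
Qed.

Lemma is_derive_flow2 u (r0 : R) p (r : R) :
  is_derive r (1 : R) (fun z => (const_flow u (z - r0) p).2)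
    (lam * (const_flow u (r - r0) p).2 + u * (c + a * (const_flow u (r - r0) p).1)).
Proof.
rewrite /const_flow /=; apply: is_derive_eq.
by rewrite /Fw /GRing.scale /=; field.
Qed.

Lemma continuous_flow u (r0 : R) p : continuous (fun z => const_flow u (z - r0) p).
Proof.
move=> r.
have H1 := is_derive_continuous _ _ _ _ (is_derive_flow1 u r0 p r).
have H2 := is_derive_continuous _ _ _ _ (is_derive_flow2 u r0 p r).
exact: (cvg_pair H1 H2).
Qed.

Inductive reach v : R -> R * R -> Prop :=
| reach0 : reach v 0 v
| reachS tau y u sig : reach v tau y -> wm <= u <= wp -> 0 <= sig ->
    reach v (tau + sig) (const_flow u sig y).

Lemma reach_ge0 v tau y : reach v tau y -> 0 <= tau.
Proof. by elim=> // *; apply: addr_ge0. Qed.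

Lemma reach_flow v u tau : wm <= u <= wp -> 0 <= tau -> reach v tau (const_flow u tau v).
Proof.
by move=> Hu H; rewrite -[tau in reach _ tau]add0r; apply: reachS H => //; exact: reach0.
Qed.

Lemma reach_trans v tau y sig z : reach v tau y -> reach y sig z -> reach v (tau + sig) z.
Proof.
move=> H; elim=> [|sig' z' u r _ IH Hu Hr]; first by rewrite addr0.
by rewrite addrA; apply: reachS.
Qed.

(** Local constancy gives [w] derivative 0 at each point of the interval, so the mean value theorem
    applies. *)
Lemma loc_const_itv w (lo hi r : R) : r \in `]lo, hi[ ->
  (forall z, z \in `]lo, hi[ -> loc_const w z) ->
  forall z, z \in `]lo, hi[ -> w z = w r.
Proof.
move=> rI H.
have dw z : z \in `]lo, hi[ -> is_derive z 1 w 0.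
  move=> /H[d d0 Hd]; apply: (near_eq_is_derive (f := cst (w z))).
  near=> q; apply/esym/Hd; rewrite distrC; near: q.
  exact: (@nbhsx_ballx _ _ z d d0).
have E z z' : z <= z' -> z \in `]lo, hi[ -> z' \in `]lo, hi[ -> w z' = w z.
  move=> zz'; rewrite !in_itv /= => /andP[z1 z2] /andP[z3 z4].
  have sub q : z <= q -> q <= z' -> q \in `]lo, hi[.
    by move=> q1 q2; rewrite in_itv /=; apply/andP; split; lra.
  have dzz' q : q \in `]z, z'[ -> is_derive q 1 w 0.
    by rewrite in_itv /= => /andP[q1 q2]; apply/dw/sub; exact: ltW.
  have czz' : {within `[z, z'], continuous w}.
    apply: derivable_within_continuous => q; rewrite in_itv /= => /andP[q1 q2].
    by case: (dw q (sub _ q1 q2)).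
  exact: (constant_itv _ w z z' zz' dzz' czz').
by move=> z zI; case: (leP z r) => [|/ltW] zr; [apply/esym|]; apply: E.
Unshelve. all: by end_near. Qed.

(** The functions s - r u and e^{-lambda r} F_u have zero derivative inside the interval, and
    continuity of [x] carries their constancy to the endpoints. The control is read at the midpoint
    because it may jump at [lo] and [hi]. *)
Lemma solution_flow w v x (lo hi : R) : is_solution lam a c w v x -> lo < hi ->
  (forall z, z \in `]lo, hi[ -> loc_const w z) ->
  x hi = const_flow (w ((lo + hi) / 2)) (hi - lo) (x lo).
Proof.
move=> [_ [cx dx]] lohi H; set u := w _.
have mI : (lo + hi) / 2 \in `]lo, hi[ by rewrite in_itv /=; apply/andP; split; lra.
have wu := loc_const_itv w lo hi _ mI H.
have cx1 : continuous (fun r => (x r).1).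
  by move=> r; apply: (continuous_comp (cx r)); exact: cvg_fst.
have cx2 : continuous (fun r => (x r).2).
  by move=> r; apply: (continuous_comp (cx r)); exact: cvg_snd.
have cexp k : continuous (fun r : R => expR (k * r)).
  move=> r; apply: (@continuous_comp _ _ _ (fun r => k * r)); last exact: continuous_expR.
  exact: mulrl_continuous.
pose f r := (x r).1 - r * u; pose g r := expR (- lam * r) * F u (x r).
have df r : r \in `]lo, hi[ -> is_derive r 1 f 0.
  move=> rI; have [d1 _] := dx _ (H r rI); apply: is_derive_eq.
  by rewrite wu // /GRing.scale /= -/u; ring.
have dg r : r \in `]lo, hi[ -> is_derive r 1 g 0.
  move=> rI; have [d1 d2] := dx _ (H r rI); apply: is_derive_eq.
  by rewrite wu // -/u /GRing.scale /= /Fw; ring.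
have cf : continuous f.
  by move=> r; apply: cvgB; [exact: cx1|exact: mulrr_continuous].
have cg : continuous g.
  move=> r; apply: cvgM; first exact: cexp.
  apply: cvgD; first by apply: cvgM; [exact: cvg_cst|exact: cx2].
  apply: cvgM; first exact: cvg_cst.
  apply: cvgD; last exact: cvg_cst.
  apply: cvgM; first exact: cvg_cst.
  apply: cvgD; first exact: cvg_cst.
  by apply: cvgM; [exact: cvg_cst|exact: cx1].
have Ef := constant_itv _ f lo hi (ltW lohi) df (continuous_subspaceT cf).
have Eg := constant_itv _ g lo hi (ltW lohi) dg (continuous_subspaceT cg).
apply: flowP; first by rewrite /f in Ef; lra.
have e1 : expR (lam * hi) * expR (- lam * hi) = 1 by rewrite -expRD mulNr subrr expR0.
have e2 : expR (lam * hi) * expR (- lam * lo) = expR (lam * (hi - lo)).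
  by rewrite -expRD; congr expR; ring.
move: Eg => /(congr1 (fun z => expR (lam * hi) * z)).
by rewrite /g !mulrA e1 e2 mul1r.
Qed.

Lemma solution_reach w v x tau : admissible wm wp w -> is_solution lam a c w v x ->
  0 <= tau -> reach v tau (x tau).
Proof.
move=> [pw Hw] sx tau0; have [D HD] := pw 0 tau.
(* Induction on the exceptional points: the interval is cut at an interior [d], and any other [d] is
   dropped. *)
suff S : forall (D : seq R) (lo hi : R), lo <= hi ->
    (forall r, r \in `]lo, hi[ -> r \notin D -> loc_const w r) ->
    reach v lo (x lo) -> reach v hi (x hi).
  apply: (S D 0) => //; last by case: sx => -> _; exact: reach0.
  by move=> r; rewrite in_itv /= => /andP[r1 r2]; apply: HD; rewrite !ltW.
move=> {D HD tau tau0}; elim=> [|d D IH] lo hi lohi H.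
  case: (ltgtP lo hi) lohi => // [lh _ r0|-> //].
  rewrite (solution_flow w v x lo hi sx lh); last by move=> r rI; apply: H.
  by rewrite -[hi in reach _ hi](subrKC lo); apply: reachS => //; rewrite subr_ge0 ltW.
have [dI|dI] := boolP (d \in `]lo, hi[); last first.
  apply: IH => // r rI rD; apply: H => //; rewrite inE negb_or rD andbT.
  by apply: contraNneq dI => <-.
have /andP[d1 d2] : lo < d < hi by move: dI; rewrite in_itv.
move=> r0; apply: (IH d hi); [exact: ltW| |apply: (IH lo d) => //; first exact: ltW].
all: move=> r; rewrite in_itv /= => /andP[r1 r2] rD; apply: H.
all: rewrite ?in_itv /= ?inE ?negb_or ?rD ?andbT; try by apply/andP; split; lra.
all: by apply/eqP => E; move: r1 r2; rewrite E ltxx.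
Qed.

(** * Realisation of concatenated arcs by admissible controls *)

Hypotheses (wm0 : wm < 0) (wp0 : 0 < wp).

Lemma cst_solution u v : is_solution lam a c (fun=> u) v (fun r => const_flow u r v).
Proof.
have E : (fun r => const_flow u r v) = (fun r => const_flow u (r - 0) v).
  by apply/funext => r; rewrite subr0.
split; first exact: flow0.
split; first by rewrite E; exact: continuous_flow.
move=> tau _; have := is_derive_flow1 u 0 v tau; have := is_derive_flow2 u 0 v tau.
rewrite !subr0; under eq_fun do rewrite subr0.
by under [X in _ -> is_derive _ _ X _ -> _]eq_fun do rewrite subr0.
Qed.

Lemma cst_admissible u : wm <= u <= wp -> admissible wm wp (fun=> u).
Proof. by move=> Hu; split=> // lo hi; exists [::] => r _ _; exists 1. Qed.

Lemma reach_solution v tau y : reach v tau y ->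
  exists w x, admissible wm wp w /\ is_solution lam a c w v x /\ x tau = y.
Proof.
elim=> [|{y}tau y u sig H [w [x [[pw Hw] [[x0 [cx dx]] xt]]]] Hu sig0].
  exists (fun=> 0), (fun r => const_flow 0 r v); split; last split.
  - by apply: cst_admissible; rewrite !ltW.
  - exact: cst_solution.
  - exact: flow0.
have tau0 := reach_ge0 _ _ _ H.
(* The value of w' at tau differs from u, so that w' is not locally constant at tau. *)
pose w' r := if r < tau then w r else if r == tau then (if u == 0 then wp else 0) else u.
(* The old trajectory frozen at [tau] plus the displacement along the new arc: a sum of continuous
   functions, so nothing has to be glued at [tau]. *)
pose x' r := x (Num.min r tau) + (const_flow u (Num.max r tau - tau) y - y).
have xl r : r <= tau -> x' r = x r.
  by move=> rt; rewrite /x' (min_idPl rt) (max_idPr rt) subrr flow0 subrr addr0.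
have xr r : tau <= r -> x' r = const_flow u (r - tau) y.
  by move=> rt; rewrite /x' (min_idPr rt) (max_idPl rt) xt subrKC.
have dist_lt (r z d : R) : `|z - r| < d -> r - d < z < r + d by rewrite ltr_distl.
exists w', x'; split; [|split].
- split.
    move=> lo hi; have [D HD] := pw lo hi; exists (tau :: D) => r rI.
    rewrite inE negb_or => /andP[rt rD].
    case: (ltgtP r tau) rt => // [rt _|tr _].
      have [d d0 Hd] := HD r rI rD; exists (Num.min d (tau - r)).
        by rewrite lt_min d0 subr_gt0.
      move=> z; rewrite lt_min => /andP[z1 /dist_lt/andP[_ z2]].
      by rewrite /w' rt (_ : z < tau) ?Hd //; lra.
    exists (r - tau); first by rewrite subr_gt0.
    move=> z /dist_lt/andP[z1 _]; have zt : tau < z by lra.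
    by rewrite /w' !ltNge !ltW //= !gt_eqF.
  move=> r; rewrite /w'; case: ifP => // _; case: ifP => // _.
  by case: ifP => _; rewrite ?lexx ?andbT !ltW // (lt_trans wm0).
- split; first by rewrite xl // x0.
  split.
    move=> r; apply: cvgD.
      apply: (@continuous_comp _ _ _ (fun r => Num.min r tau) x); last exact: cx.
      by apply: (@continuous_min _ _ (fun r : R => r) (fun=> tau)); [exact: cvg_id|exact: cvg_cst].
    apply: cvgB; last exact: cvg_cst.
    apply: (@continuous_comp _ _ _ (fun r => Num.max r tau) (fun r => const_flow u (r - tau) y)).
      by apply: (@continuous_max _ _ (fun r : R => r) (fun=> tau)); [exact: cvg_id|exact: cvg_cst].
    exact: continuous_flow.
  move=> r [d d0 Hd]; case: (ltgtP r tau) => [rt|tr|E].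
  + have E : w' r = w r by rewrite /w' rt.
    have N : \near r, x r = x' r.
      by near=> z; rewrite xl // ltW //; near: z; exact: lt_nbhsl.
    have [|d1 d2] := dx r.
      exists (Num.min d (tau - r)); first by rewrite lt_min d0 subr_gt0.
      move=> z; rewrite lt_min => /andP[z1 /dist_lt/andP[_ z2]].
      by have := Hd z z1; rewrite E /w' (_ : z < tau) //; lra.
    rewrite E xl ?ltW //; split; [move: d1|move: d2]; apply: near_eq_is_derive.
      by near=> z; rewrite (near N z).
    by near=> z; rewrite (near N z).
  + have E : w' r = u by rewrite /w' ltNge ltW //= gt_eqF.
    have N : \near r, const_flow u (r - tau) y = x' r.
      by near=> z; rewrite xr // ltW //; near: z; exact: lt_nbhsr.
    rewrite E xr ?ltW //; split.
      apply: near_eq_is_derive; last exact: (is_derive_flow1 u tau y r).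
      by near=> z; rewrite (near N z).
    apply: near_eq_is_derive; last exact: (is_derive_flow2 u tau y r).
    by near=> z; rewrite (near N z).
  + have := Hd (tau + d / 2); rewrite E /w' ltxx eqxx.
    rewrite addrAC subrr add0r gtr0_norm ?divr_gt0 // ltr_pdivrMr // ltr_pMr // ltr1n => /(_ isT).
    rewrite ltNge lerDl ltW ?divr_gt0 //= gt_eqF ?ltrDl ?divr_gt0 //.
    by case: (u =P 0) => [-> E0|u0 /u0 //]; move: wp0; rewrite -E0 ltxx.
- by rewrite xr ?lerDl // addrAC subrr add0r.
Unshelve. all: by end_near. Qed.

Lemma orbit_plusP v y : orbit_plus lam a c wm wp v y <-> exists tau, reach v tau y.
Proof.
split=> [[w [x [tau [Hw [sx [tau0 <-]]]]]]|[tau H]].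
  by exists tau; exact: (solution_reach w).
have [w [x [Hw [sx <-]]]] := reach_solution _ _ _ H.
by exists w, x, tau; split=> //; split=> //; split=> //; exact: reach_ge0 H.
Qed.

End Flow.

(** * Obstructions to recurrence; functions decaying along the flow *)

Section Generic.
Variables (R : realType) (lam a c wm wp : R).
Hypotheses (lam0 : lam != 0) (wm0 : wm < 0) (wp0 : 0 < wp).
Local Notation F := (Fw lam a c).
Local Notation flow := (const_flow R lam a c).
Local Notation reach := (reach R lam a c wm wp).
Local Notation invariant := (ctrl_invariant lam a c wm wp).
Local Notation approx := (approx_ctrl lam a c wm wp).
Implicit Types (u tau sig s t : R) (p v y : R * R) (A C D : set (R * R)).

Lemma closure_vertical A s t :
  (forall e, 0 < e -> exists2 t', A (s, t') & `|t - t'| < e) -> closure A (s, t).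
Proof.
move=> H B /nbhs_ballP[e /= e0 He]; have [t' At' Ht'] := H e e0.
by exists (s, t'); split=> //; apply: He; split=> //=; exact: ballxx.
Qed.

Lemma control_set_unique C : C !=set0 -> invariant C -> approx C ->
  (forall D, invariant D -> approx D -> D `<=` C) ->
  control_set lam a c wm wp C /\ forall D, control_set lam a c wm wp D -> D = C.
Proof.
move=> C0 iC aC maxC; split=> [|D [_ [iD [aD maxD]]]].
  split=> //; split=> //; split=> // D _ iD aD CD.
  by apply/seteqP; split=> //; exact: maxC.
by apply/esym/maxD => //; exact: maxC.
Qed.

(** Invariance puts into [D] some point reached from [v] in time 1, and approximate controllability
    makes the orbit of that point accumulate at [v]. A closed [K] that traps the orbit and misses
    [v] forbids this. *)
Lemma no_return D v : invariant D -> approx D ->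
  (forall y, reach v 1 y ->
     exists2 K, closed K /\ ~ K v & forall tau z, reach y tau z -> K z) ->
  ~ D v.
Proof.
move=> iD aD H Dv; have [w [x [Hw [sx xD]]]] := iD _ Dv.
have r1 := solution_reach _ lam a c wm wp lam0 _ _ _ _ Hw sx ler01.
have [K [clK nKv] HK] := H _ r1; apply: nKv.
rewrite (closure_id K).1 //; apply: (closureS _ (aD _ (xD 1 ler01) _ Dv)).
by move=> z /(orbit_plusP _ _ _ _ _ _ lam0 wm0 wp0)[tau]; exact: HK.
Qed.

Definition decays (G : R * R -> R) := forall u sig p,
  wm <= u <= wp -> 0 <= sig -> G (flow u sig p) <= expR (lam * sig) * G p.

Lemma decays_reach G v tau y : decays G -> reach v tau y ->
  G y <= expR (lam * tau) * G v.
Proof.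
move=> dG; elim=> [|{y}tau' y u sig _ IH Hu Hs]; first by rewrite mulr0 expR0 mul1r.
rewrite (mulrDr lam) addrC expRD; apply: (le_trans (dG _ _ _ Hu Hs)).
by rewrite -mulrA ler_wpM2l ?expR_ge0.
Qed.

(** If [G v] were positive, then after time 1 [G] would be at most e^lambda G v < G v and stay so
    forever; this closed sublevel set misses [v]. *)
Lemma decays_le0 D G : lam < 0 -> continuous G -> decays G ->
  invariant D -> approx D -> D `<=` [set p | G p <= 0].
Proof.
move=> ln cG dG iD aD v Dv /=; rewrite leNgt; apply/negP => Gv.
apply: (no_return D v iD aD _ Dv) => y /(decays_reach _ _ _ _ dG) Gy.
have e1 : expR (lam * 1) * G v < G v by rewrite mulr1 gtr_pMl // expR_lt1.
have e0 : 0 <= expR (lam * 1) * G v by rewrite mulr_ge0 ?expR_ge0 // ltW.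
exists [set p | G p <= expR (lam * 1) * G v].
  split; last by rewrite /= leNgt e1.
  rewrite (_ : mkset _ = G @^-1` [set r | r <= expR (lam * 1) * G v]) //.
  apply: preimage_closed; [by move=> z _; exact: cG|exact: closed_le].
move=> tau z zr /=; have t0 := reach_ge0 _ _ _ _ _ _ _ _ _ zr.
apply: (le_trans (decays_reach _ _ _ _ dG zr)).
apply: (le_trans (ler_wpM2l (expR_ge0 _) Gy)).
by rewrite ler_piMl // expR_le1 mulr_le0_ge0 // ltW.
Qed.

(* A constant control crosses the line s = L at most once. *)
Lemma decays_split (L : R) (G : R * R -> R) :
  (forall u sig p, wm <= u <= wp -> 0 <= sig ->
     (p.1 <= L /\ p.1 + sig * u <= L) \/ (L <= p.1 /\ L <= p.1 + sig * u) ->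
     G (flow u sig p) <= expR (lam * sig) * G p) ->
  decays G.
Proof.
move=> H u sig p Hu Hs.
have cross : (p.1 - L) * (p.1 + sig * u - L) < 0 ->
    G (flow u sig p) <= expR (lam * sig) * G p.
  move=> neg; have u0 : u != 0.
    by apply: contraTneq neg => ->; rewrite mulr0 addr0 -leNgt -expr2 sqr_ge0.
  (* The time at which the arc meets s = L; the estimates before and after it are composed. *)
  pose r := (L - p.1) / u; have ru : r * u = L - p.1 by rewrite /r divfK.
  have [r0 rs] : 0 <= r /\ r <= sig.
    have E1 : - r * (sig - r) * u ^+ 2 = (p.1 - L) * (p.1 + sig * u - L).
      by rewrite (_ : L = p.1 + r * u); [ring|rewrite ru; ring].
    have u2 : 0 < u ^+ 2 by rewrite exprn_even_gt0.
    have E2 : - r * (sig - r) < 0 by rewrite -(pmulr_llt0 _ u2) E1.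
    by split; rewrite leNgt; apply/negP => h; nra.
  have fr : (flow u r p).1 = L by rewrite /= ru; ring.
  have -> : sig = r + (sig - r) by ring.
  rewrite flowD // (mulrDr lam r) [lam * r + _]addrC expRD -mulrA.
  have Hrs : 0 <= sig - r by rewrite subr_ge0.
  apply: (@le_trans _ _ (expR (lam * (sig - r)) * G (flow u r p))).
    by apply: H => //; rewrite fr; case: (leP 0 u) => [|/ltW] us; [right|left]; split=> //; nra.
  rewrite ler_wpM2l ?expR_ge0 //; apply: H => //; rewrite ru.
  by case: (leP p.1 L) => [|/ltW] pL; [left|right]; split=> //; lra.
have [/cross //|nn] := ltP ((p.1 - L) * (p.1 + sig * u - L)) 0.
apply: H => //; have [h|h|h] := ltgtP p.1 L.
- by left; split=> //; nra.
- by right; split=> //; nra.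
- by have [?|/ltW ?] := leP (p.1 + sig * u) L; [left|right].
Qed.

End Generic.

(** * The case a = 0: strips of equilibrium levels *)

Section CaseZero.
Variables (R : realType) (lam k wm wp : R).
Hypotheses (lam0 : lam != 0) (k0 : k != 0) (wm0 : wm < 0) (wp0 : 0 < wp).
Local Notation c := (- (k * lam)).
Local Notation flow := (const_flow R lam 0 c).
Local Notation reach := (reach R lam 0 c wm wp).
Local Notation orb := (orbit_plus lam 0 c wm wp).
Local Notation invariant := (ctrl_invariant lam 0 c wm wp).
Local Notation approx := (approx_ctrl lam 0 c wm wp).
Local Notation level p := (p.2 / k).
Implicit Types (u tau sig s t : R) (p v y : R * R) (A C D : set (R * R)).

(** With k = - c / lambda, the level l = t / k obeys l' = lambda (l - u), so level [u] is an
    equilibrium of the control [u]. Dividing by [k] avoids a discussion of its sign. *)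
Definition closed_strip := [set p : R * R | wm <= level p <= wp].
Definition open_strip := [set p : R * R | wm < level p < wp].

Lemma open_strip_closed : open_strip `<=` closed_strip.
Proof. by move=> p /= /andP[? ?]; rewrite /closed_strip /= !ltW. Qed.

Lemma level_flow u tau p :
  level (flow u tau p) = u + (level p - u) * expR (lam * tau).
Proof. by rewrite /const_flow /Fw /=; field; rewrite lam0 k0. Qed.

(** An end [e] of Omega is applied for the time solving the equation. For lambda < 0 it attracts, so
    [e] is taken beyond [m], which must not equal it; for lambda > 0 it repels, so [e] is taken
    behind [l], which must not be this equilibrium. *)
Lemma steer_level (l m : R) : wm <= l <= wp -> wm <= m <= wp ->
  (lam < 0 /\ wm < m < wp) \/ (0 < lam /\ wm < l < wp) ->
  exists u tau, [/\ wm <= u <= wp, 0 <= tau & u + (l - u) * expR (lam * tau) = m].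
Proof.
have [wm0' wp0'] := (wm0, wp0).
move=> Hl Hm H.
suff S e : wm <= e <= wp -> 0 < (m - e) / (l - e) ->
    0 <= ln ((m - e) / (l - e)) / lam ->
    exists u tau, [/\ wm <= u <= wp, 0 <= tau & u + (l - u) * expR (lam * tau) = m].
  have [<-|lm] := eqVneq l m.
    exists 0, 0; split=> //; first by rewrite !ltW.
    by rewrite mulr0 expR0; ring.
  case: H => [[ln Hm']|[lp Hl']].
    pose e := if l < m then wp else wm.
    have [me [ml ee]] : 0 < (m - e) / (l - e) /\ (m - e) / (l - e) <= 1 /\ wm <= e <= wp.
      rewrite /e; case: ifP => lm'; last first.
        have lm'' : m < l by rewrite lt_neqAle eq_sym lm leNgt lm'.
        by split; [rewrite divr_gt0 //|split; [rewrite ler_pdivrMr ?mul1r|]]; lra.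
      rewrite -mulrNN -invrN !opprB.
      by split; [rewrite divr_gt0 //|split; [rewrite ler_pdivrMr ?mul1r|]]; lra.
    by apply: (S e ee me); rewrite mulr_le0 ?invr_le0 ?ln_le0 // ltW.
  pose e := if l < m then wm else wp.
  have [ml ee] : 1 <= (m - e) / (l - e) /\ wm <= e <= wp.
    rewrite /e; case: ifP => lm'.
      by split; [rewrite ler_pdivlMr ?mul1r|]; lra.
    have lm'' : m < l by rewrite lt_neqAle eq_sym lm leNgt lm'.
    rewrite -mulrNN -invrN !opprB.
    by split; [rewrite ler_pdivlMr ?mul1r|]; lra.
  by apply: (S e ee); [exact: lt_le_trans ml|rewrite divr_ge0 ?ln_ge0 // ltW].
move=> ee pos tau0; exists e, (ln ((m - e) / (l - e)) / lam); split=> //.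
rewrite [lam * _]mulrC divfK // lnK //.
have : l - e != 0 by apply: contraTneq pos => ->; rewrite invr0 mulr0 ltxx.
by move=> le; field.
Qed.

Lemma strip_reach v y : closed_strip v -> open_strip y -> lam < 0 \/ open_strip v ->
  exists tau, reach v tau y.
Proof.
have [wm0' wp0'] := (wm0, wp0).
move=> Hv /= Hy' H; have Hy : wm <= level y <= wp by case/andP: Hy' => *; rewrite !ltW.
have Hp : wm < wp / 2 < wp by apply/andP; split; lra.
have Hm : wm < wm / 2 < wp by apply/andP; split; lra.
have Hp' : wm <= wp / 2 <= wp by apply/andP; split; lra.
have Hm' : wm <= wm / 2 <= wp by apply/andP; split; lra.
have [|u1 [t1 [Hu1 Ht1 E1]]] := steer_level _ _ Hv Hp'.
  have := lam0; rewrite neq_lt => /orP[ln|lp]; [by left|right; split=> //].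
  by case: H => // ln; have := lt_trans ln lp; rewrite ltxx.
have [|u3 [t3 [Hu3 Ht3 E3]]] := steer_level _ _ Hp' Hm'.
  by move: lam0; rewrite neq_lt => /orP[] ?; [left|right].
have [|u5 [t5 [Hu5 Ht5 E5]]] := steer_level _ _ Hm' Hy.
  by move: lam0; rewrite neq_lt => /orP[] ?; [left|right].
(* What the three steering arcs leave of the displacement in s. Sliding at level wp / 2 moves right
   and at level wm / 2 moves left, so one of the sliding times can be 0. *)
pose d := y.1 - v.1 - t1 * u1 - t3 * u3 - t5 * u5.
have [t2 [t4 [Ht2 Ht4 E24]]] : exists t2 t4,
    [/\ 0 <= t2, 0 <= t4 & t2 * (wp / 2) + t4 * (wm / 2) = d].
  have [d0|/ltW d0] := leP 0 d.
    by exists (d / (wp / 2)), 0; split=> //; [rewrite divr_ge0 //; lra|field; lra].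
  exists 0, (d / (wm / 2)); split=> //; last by field; lra.
  by rewrite mulr_le0 // invr_le0; lra.
pose z1 := flow u1 t1 v; pose z2 := flow (wp / 2) t2 z1; pose z3 := flow u3 t3 z2.
pose z4 := flow (wm / 2) t4 z3.
exists (t1 + t2 + t3 + t4 + t5).
suff -> : y = flow u5 t5 z4.
  by do 4 (apply: reachS => //); exact: reach_flow.
have L1 : level z1 = wp / 2 by rewrite level_flow.
have L2 : level z2 = wp / 2 by rewrite level_flow L1; ring.
have L3 : level z3 = wm / 2 by rewrite level_flow L2.
have L4 : level z4 = wm / 2 by rewrite level_flow L3; ring.
have L5 : level (flow u5 t5 z4) = level y by rewrite level_flow L4.
rewrite [LHS]surjective_pairing [RHS]surjective_pairing; congr pair; last first.
  by rewrite -(divfK k0 y.2) -L5 divfK.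
by rewrite /=; move: E24; rewrite /d; lra.
Qed.

(** The control equal to the current level keeps that level constant. *)
Lemma strip_invariant (P : R -> Prop) : (forall r, P r -> wm <= r <= wp) ->
  invariant [set p | P (level p)].
Proof.
move=> HP v /= Pv; exists (fun=> level v), (fun r => flow (level v) r v); split.
  exact: cst_admissible (HP _ Pv).
split; first exact: cst_solution.
by move=> tau _; rewrite level_flow subrr mul0r addr0.
Qed.

Lemma strip_invariants : invariant closed_strip /\ invariant open_strip.
Proof.
split; first exact: (strip_invariant (fun r => wm <= r <= wp)).
by apply: (strip_invariant (fun r => wm < r < wp)) => r /andP[? ?]; rewrite !ltW.
Qed.

Lemma continuous_level : continuous (fun p : R * R => level p).
Proof. by move=> p; apply: cvgM; [exact: cvg_snd|exact: cvg_cst]. Qed.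

Lemma closed_closed_strip : closed closed_strip.
Proof.
rewrite (_ : closed_strip = (fun p => level p) @^-1` ([set r | wm <= r] `&` [set r | r <= wp])).
  apply: preimage_closed; first by move=> p _; exact: continuous_level.
  by apply: closedI; [exact: closed_ge|exact: closed_le].
by apply/seteqP; split=> p /=; [move=> /andP|move=> [? ?]; apply/andP].
Qed.

Lemma open_open_strip : open open_strip.
Proof.
rewrite (_ : open_strip = (fun p => level p) @^-1` ([set r | wm < r] `&` [set r | r < wp])).
  apply: open_comp; first by move=> p _; exact: continuous_level.
  by apply: openI; [exact: open_gt|exact: open_lt].
by apply/seteqP; split=> p /=; [move=> /andP|move=> [? ?]; apply/andP].
Qed.

Lemma closure_open_strip : closure open_strip = closed_strip.
Proof.
apply/seteqP; split.
  rewrite (closure_id closed_strip).1; last exact: closed_closed_strip.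
  exact: closureS open_strip_closed.
have [wm0' wp0'] := (wm0, wp0).
move=> [s t] /= Hl; apply: closure_vertical => e e0.
(* Scaling [t] by [1 - d] moves its level towards 0, an interior point of Omega; [d] is small enough
   for the shift to stay below [e]. *)
pose d := Num.min (1 / 2) (e / (2 * (1 + `|t|))).
have tp : 0 < 1 + `|t| by rewrite ltr_pwDl.
have d0 : 0 < d by rewrite lt_min divr_gt0 //= divr_gt0 // mulr_gt0.
have d2 : d <= 1 / 2 by rewrite ge_min lexx.
have d3 : d * (1 + `|t|) <= e / 2.
  rewrite -ler_pdivlMr // -mulrA -invfM; by rewrite ge_min lexx orbT.
exists ((1 - d) * t).
  rewrite /open_strip /= -mulrA; move: Hl; set l := t / k => /andP[h1 h2].
  have d1 : 0 <= 1 - d by lra.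
  have q1 : 0 <= (1 - d) * (l - wm) by rewrite mulr_ge0 // subr_ge0.
  have q2 : 0 <= (1 - d) * (wp - l) by rewrite mulr_ge0 // subr_ge0.
  have q3 : 0 < d * wp by rewrite mulr_gt0.
  have q4 : d * wm < 0 by rewrite pmulr_rlt0.
  by apply/andP; split; lra.
rewrite (_ : t - _ = d * t); last by ring.
by rewrite normrM gtr0_norm //; have := normr_ge0 t; lra.
Qed.

Lemma strip_bound_neg D : lam < 0 -> invariant D -> approx D -> D `<=` closed_strip.
Proof.
move=> ln iD aD v Dv.
have E1 sig : 0 <= sig -> expR (lam * sig) <= 1.
  by move=> ?; rewrite expR_le1 mulr_le0_ge0 // ltW.
have P1 : decays _ lam 0 c wm wp (fun p => level p - wp).
  move=> u sig p /andP[h1 h2] /E1 h3; rewrite level_flow.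
  by rewrite -subr_ge0 (_ : _ - _ = (wp - u) * (1 - expR (lam * sig))); [rewrite mulr_ge0 //; lra|ring].
have P2 : decays _ lam 0 c wm wp (fun p => wm - level p).
  move=> u sig p /andP[h1 h2] /E1 h3; rewrite level_flow.
  by rewrite -subr_ge0 (_ : _ - _ = (u - wm) * (1 - expR (lam * sig))); [rewrite mulr_ge0 //; lra|ring].
have C1 : continuous (fun p : R * R => level p - wp).
  by move=> p; apply: cvgB; [exact: continuous_level|exact: cvg_cst].
have C2 : continuous (fun p : R * R => wm - level p).
  by move=> p; apply: cvgB; [exact: cvg_cst|exact: continuous_level].
have := decays_le0 _ _ _ _ _ _ lam0 wm0 wp0 _ _ ln C1 P1 iD aD _ Dv.
have := decays_le0 _ _ _ _ _ _ lam0 wm0 wp0 _ _ ln C2 P2 iD aD _ Dv.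
by rewrite /= /closed_strip /= !subr_le0 => -> ->.
Qed.

(* level + lam * s has derivative lam * level, so it is strictly monotone off
   the strip, which for lam > 0 is never re-entered. *)
Lemma outside_reach (e w0 : R) v tau y : 0 < lam -> 0 < e * w0 ->
  (forall u, wm <= u <= wp -> e * u <= e * w0) ->
  e * w0 <= e * level v -> reach v tau y ->
  e * w0 <= e * level y /\
  e * (level v + lam * v.1) + lam * (e * w0) * tau <= e * (level y + lam * y.1).
Proof.
move=> lp ew0 Hw Hv; elim=> [|{y}tau' y u sig _ [IH1 IH2] /Hw Hu Hs].
  by split=> //; rewrite mulr0 addr0.
have := expR_ge1Dx (lam * sig); rewrite level_flow /=.
set E := expR _; set l := level y in IH1 IH2 *; move=> HE.
have h0 : 0 <= lam * sig by rewrite mulr_ge0 // ltW.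
split.
  by rewrite (_ : e * (_ + _) = e * l + e * (l - u) * (E - 1)); [nra|ring].
(* After 1 + z <= e^z has linearised the change of level, its term in [u] cancels against the one
   from lambda s, leaving e l lambda sig. *)
have h1 : e * (l - u) * (lam * sig) <= e * (l - u) * (E - 1).
  by apply: ler_wpM2l; lra.
have h2 : e * w0 * (lam * sig) <= e * l * (lam * sig) by apply: ler_wpM2r.
have -> : e * (u + (l - u) * E + lam * (y.1 + sig * u)) =
    e * (l + lam * y.1) + e * (l - u) * (E - 1) + lam * sig * (e * u) by ring.
by clearbody E l; lra.
Qed.

(** The sign [e] is 1 above the strip and -1 below it, [w0] being the end of Omega on that side.
    Boundary points are excluded too: [V] gains at least lambda e w0 in time 1 and never falls
    back. *)
Lemma outside_not_recurrent (e w0 : R) D v : 0 < lam -> 0 < e * w0 ->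
  (forall u, wm <= u <= wp -> e * u <= e * w0) -> e * w0 <= e * level v ->
  invariant D -> approx D -> ~ D v.
Proof.
move=> lp ew0 Hw Hv iD aD; apply: (no_return _ _ _ _ _ _ lam0 wm0 wp0 _ _ iD aD) => y Hy.
have [Y1 Y2] := outside_reach _ _ _ _ _ lp ew0 Hw Hv Hy.
pose V (p : R * R) := e * (level p + lam * p.1).
have cV : continuous V.
  move=> p; apply: cvgM; first exact: cvg_cst.
  apply: cvgD; first exact: continuous_level.
  by apply: cvgM; [exact: cvg_cst|exact: cvg_fst].
have l0 : 0 < lam * (e * w0) by rewrite mulr_gt0.
exists (V @^-1` [set r | V y <= r]).
  split; last by rewrite /= /V; apply/negP; rewrite -ltNge; lra.
  by apply: preimage_closed; [move=> z _; exact: cV|exact: closed_ge].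
move=> tau z Hz /=; have t0 := reach_ge0 _ _ _ _ _ _ _ _ _ Hz.
have [_] := outside_reach _ _ _ _ _ lp ew0 Hw Y1 Hz.
by apply: le_trans; rewrite /V lerDl mulr_ge0 // ltW.
Qed.

Lemma strip_bound_pos D : 0 < lam -> invariant D -> approx D -> D `<=` open_strip.
Proof.
move=> lp iD aD v Dv; rewrite /open_strip /=; apply/andP; split; rewrite ltNge; apply/negP => h.
  by apply: (outside_not_recurrent (-1) wm D v) => //;
      rewrite ?mulN1r ?oppr_gt0 ?lerN2 // => u /andP[? ?]; rewrite !mulN1r lerN2.
by apply: (outside_not_recurrent 1 wp D v) => //; rewrite ?mul1r // => u /andP[? ?]; rewrite !mul1r.
Qed.

Lemma zero_open_strip : open_strip (0, 0).
Proof. by rewrite /open_strip /= mul0r wm0 wp0. Qed.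

Lemma strip_reach_orbit v y : closed_strip v -> open_strip y ->
  lam < 0 \/ open_strip v -> orb v y.
Proof. by move=> Hv Hy H; apply/orbit_plusP => //; exact: strip_reach. Qed.

Lemma control_set_zero :
  exists C, control_set lam 0 c wm wp C /\
    (forall D, control_set lam 0 c wm wp D -> D = C) /\
    closure C = closed_strip /\ (lam < 0 -> closed C) /\ (0 < lam -> open C).
Proof.
have [ic io] := strip_invariants.
have := lam0; rewrite neq_lt => /orP[ln|lp].
  have [||||h1 h2] := control_set_unique _ lam 0 c wm wp closed_strip.
  - by exists (0, 0); exact: open_strip_closed zero_open_strip.
  - exact: ic.
  - move=> v Cv; rewrite -closure_open_strip; apply: closureS => y Hy.
    by apply: strip_reach_orbit => //; left.
  - by move=> D; exact: strip_bound_neg.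
  exists closed_strip; split=> //; split=> //; split.
    by rewrite -(closure_id closed_strip).1 //; exact: closed_closed_strip.
  by split=> [_|]; [exact: closed_closed_strip|lra].
have [||||h1 h2] := control_set_unique _ lam 0 c wm wp open_strip.
- by exists (0, 0); exact: zero_open_strip.
- exact: io.
- move=> v Cv y Hy; apply: subset_closure.
  by apply: strip_reach_orbit => //; [exact: open_strip_closed|right].
- by move=> D; exact: strip_bound_pos.
exists open_strip; split=> //; split=> //; split; first exact: closure_open_strip.
by split=> [|_]; [lra|exact: open_open_strip].
Qed.

End CaseZero.

(** * Exponential inequalities *)

Section ExpInequalities.
Variable R : realType.
Implicit Types (lam x r z y u A K : R).

(* With X = x + r z, the function e^{-lam z} (e^{lam X} - lam X - 1 + r (lam X + r))
   of z has derivative - lam (1 - r) e^{-lam z} (e^{lam X} - lam X - 1) >= 0. *)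
Lemma arc_monotone lam x r z : lam < 0 -> r <= 1 -> 0 <= z ->
  expR (lam * z) * (expR (lam * x) - lam * x - 1 + r * (lam * x + r)) <=
  expR (lam * (x + r * z)) - lam * (x + r * z) - 1 + r * (lam * (x + r * z) + r).
Proof.
move=> ln r1 z0.
pose g X := expR (lam * X) - lam * X - 1 + r * (lam * X + r).
rewrite -/(g x) -/(g (x + r * z)).
pose h (q : R) := expR (- lam * q) * g (x + r * q).
pose dh (q : R) := expR (- lam * q) * (- lam * (1 - r) *
  (expR (lam * (x + r * q)) - (1 + lam * (x + r * q)))).
have Dh (q : R) : is_derive q (1 : R) h (dh q).
  rewrite /h /g; apply: is_derive_eq.
  by rewrite /GRing.scale /= /dh; ring.
have ch : continuous h by move=> q; exact: is_derive_continuous (Dh q).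
have [q _ E] := MVT_segment z0 (fun q _ => Dh q) (continuous_subspaceT ch).
have : h 0 <= h z.
  rewrite -subr_ge0 E subr0 mulr_ge0 // mulr_ge0 ?expR_ge0 //.
  rewrite mulr_ge0 ?subr_ge0 ?expR_ge1Dx // mulr_ge0 //; lra.
rewrite /h !mulr0 expR0 mul1r addr0 => H.
apply: (le_trans (ler_wpM2l (expR_ge0 _) H)).
by rewrite mulrA -expRD (_ : lam * z + - lam * z = 0) ?expR0 ?mul1r //; ring.
Qed.

(** Needed for [bottom_decays] with y = - lambda sig, where [u * y <= A] holds because the arc does
    not change sides. The case u > 0 rests on e^{-y} (1 + y) <= 1, the case u <= 0 on 1 - e^{-y} <=
    y. *)
Lemma one_sub_expR_ge A u y : 0 <= A -> u * y <= A -> 0 <= y ->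
  u * y <= (A + u) * (1 - expR (- y)).
Proof.
move=> A0 uyA y0; have h1 := expR_ge1Dx (- y); have h2 := expR_ge1Dx y.
have h3 : expR (- y) <= 1 by rewrite expR_le1 oppr_le0.
have h4 : expR (- y) * (1 + y) <= 1.
  have e1 : expR (- y) * expR y = 1 by rewrite -expRD addrC subrr expR0.
  by rewrite -[leRHS]e1 ler_wpM2l ?expR_ge0.
set E := expR (- y) in h1 h3 h4 *.
have [u0|u0] := leP 0 u.
  have h5 : 0 <= (A - u * y) * (1 - E) by rewrite mulr_ge0 ?subr_ge0.
  have h6 : 0 <= u * (1 - E * (1 + y)) by rewrite mulr_ge0 ?subr_ge0.
  by rewrite -subr_ge0 (_ : _ - _ = (A - u * y) * (1 - E) + u * (1 - E * (1 + y))); [lra|ring].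
have h5 : 0 <= A * (1 - E) by rewrite mulr_ge0 ?subr_ge0.
have h6 : 0 <= - u * (y - (1 - E)) by rewrite mulr_ge0 //; lra.
by rewrite -subr_ge0 (_ : _ - _ = A * (1 - E) + - u * (y - (1 - E))); [lra|ring].
Qed.

(** With half the rate, [q], one has e^{-lambda K} = (e^{q K})^2 >= (1 + q K)^2, and [K] makes one
    factor exceed B / e. *)
Lemma expR_linear_small lam M e : lam < 0 -> 0 <= M -> 0 < e ->
  exists2 K, 0 <= K & expR (lam * K) * (M * (1 + K)) < e.
Proof.
move=> ln M0 e0; pose q := - lam / 2; have q0 : 0 < q by rewrite /q; lra.
pose B := M * (1 + q^-1); have B0 : 0 <= B by rewrite mulr_ge0 // addr_ge0 // invr_ge0 ltW.
have Be0 : 0 <= B / e by rewrite divr_ge0 // ltW.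
pose K := B / e / q; have K0 : 0 <= K by rewrite divr_ge0 // ltW.
exists K => //.
have qK : q * K = B / e by rewrite mulrC divfK // gt_eqF.
have qK0 : 0 <= q * K by rewrite mulr_ge0 // ltW.
have h1 : M * (1 + K) <= B * (1 + q * K).
  rewrite /B -subr_ge0 (_ : _ - _ = M * (q * K + q^-1)); last by field; rewrite ?gt_eqF.
  by rewrite mulr_ge0 // addr_ge0 // invr_ge0 ltW.
have h2 : B * (1 + q * K) < e * (expR (q * K) * expR (q * K)).
  have H := expR_ge1Dx (q * K).
  have h3 : B < e * (1 + q * K) by rewrite qK mulrDr mulr1 mulrCA divff ?gt_eqF // mulr1 ltrDr.
  apply: (@lt_le_trans _ _ (e * (1 + q * K) * (1 + q * K))).
    by rewrite ltr_pM2r // ltr_pwDl.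
  have h4 : 0 <= 1 + q * K by rewrite addr_ge0.
  by rewrite -mulrA ler_wpM2l ?(ltW e0) // ler_pM.
rewrite -(ltr_pM2l (expR_gt0 (- lam * K))) mulrA -expRD.
rewrite (_ : - lam * K + lam * K = 0) ?expR0 ?mul1r; last by ring.
apply: (le_lt_trans h1); apply: (lt_le_trans h2).
by rewrite -expRD mulrC (_ : - lam * K = q * K + q * K) // /q; field.
Qed.

End ExpInequalities.

(** * The case a > 0, lambda < 0: the two decaying functions *)

Section CasePos.
Variables (R : realType) (lam a c wm wp : R).
Hypotheses (ln : lam < 0) (a0 : 0 < a) (wm0 : wm < 0) (wp0 : 0 < wp).
Local Notation F := (Fw lam a c).
Local Notation flow := (const_flow R lam a c).
Local Notation reach := (reach R lam a c wm wp).
Local Notation invariant := (ctrl_invariant lam a c wm wp).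
Local Notation approx := (approx_ctrl lam a c wm wp).
Local Notation decays := (decays R lam a c wm wp).
Implicit Types (u w tau sig s t : R) (p v y : R * R) (C D : set (R * R)).

Let lam0 : lam != 0. Proof. by rewrite lt_eqF. Qed.
Let an0 : a != 0. Proof. by rewrite gt_eqF. Qed.
Let wmn0 : wm != 0. Proof. by rewrite lt_eqF. Qed.
Let wpn0 : wp != 0. Proof. by rewrite gt_eqF. Qed.

(* arc w x is the height at s = - c / a + x of the trajectory issued from
   v_a = (- c / a, 0) under the constant control w. *)
Definition arc w x := a * w ^+ 2 / lam ^+ 2 * (expR (lam * (x / w)) - lam * (x / w) - 1).
Definition top s := arc wp (Num.max (s + c / a) 0) + arc wm (Num.min (s + c / a) 0).

Lemma arc0 w : arc w 0 = 0.
Proof. by rewrite /arc mul0r mulr0 expR0 subr0 subrr mulr0. Qed.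

Lemma arc_ge0 w x : 0 <= arc w x.
Proof.
rewrite mulr_ge0 //; last by have := expR_ge1Dx (lam * (x / w)); lra.
by rewrite divr_ge0 ?sqr_ge0 // mulr_ge0 ?sqr_ge0 // ltW.
Qed.

Lemma arc_le w x : w != 0 -> 0 <= x / w -> arc w x <= a * w * x / - lam.
Proof.
move=> w0 xw; have h : expR (lam * (x / w)) <= 1 by rewrite expR_le1 mulr_le0_ge0 // ltW.
have -> : a * w * x / - lam = a * w ^+ 2 / lam ^+ 2 * (- lam * (x / w)).
  by field; rewrite ?w0 ?oppr_eq0 ?lam0.
apply: ler_wpM2l; last by lra.
by rewrite divr_ge0 ?sqr_ge0 // mulr_ge0 ?sqr_ge0 // ltW.
Qed.

Lemma top_pos s : 0 <= s + c / a -> top s = arc wp (s + c / a).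
Proof. by move=> h; rewrite /top max_l // min_r // arc0 addr0. Qed.

Lemma top_neg s : s + c / a <= 0 -> top s = arc wm (s + c / a).
Proof. by move=> h; rewrite /top max_r // min_l // arc0 add0r. Qed.

Lemma top_ge0 s : 0 <= top s.
Proof. by rewrite addr_ge0 // arc_ge0. Qed.

Lemma continuous_top : continuous top.
Proof.
have cS : continuous (fun s : R => s + c / a).
  by move=> s; apply: cvgD; [exact: cvg_id|exact: cvg_cst].
have cA w : continuous (arc w).
  have cl : continuous (fun x : R => lam * (x / w)).
    by move=> x; apply: cvgM; [exact: cvg_cst|exact: mulrr_continuous].
  move=> x; apply: cvgM; first exact: cvg_cst.
  apply: cvgB; last exact: cvg_cst.
  apply: cvgB; last exact: cl.
  by apply: (continuous_comp (cl x)); exact: continuous_expR.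
move=> s; apply: cvgD.
  apply: (@continuous_comp _ _ _ (fun s : R => Num.max (s + c / a) 0) (arc wp)); last exact: cA.
  by apply: (@continuous_max _ _ (fun s : R => s + c / a) (fun=> 0)); [exact: cS|exact: cvg_cst].
apply: (@continuous_comp _ _ _ (fun s : R => Num.min (s + c / a) 0) (arc wm)); last exact: cA.
by apply: (@continuous_min _ _ (fun s : R => s + c / a) (fun=> 0)); [exact: cS|exact: cvg_cst].
Qed.

Lemma continuous_Fw w : continuous (F w).
Proof.
move=> p; apply: cvgD; first by apply: cvgM; [exact: cvg_cst|exact: cvg_snd].
apply: cvgM; first exact: cvg_cst.
apply: cvgD; last exact: cvg_cst.
apply: cvgM; first exact: cvg_cst.
apply: cvgD; first exact: cvg_cst.
by apply: cvgM; [exact: cvg_cst|exact: cvg_fst].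
Qed.

Lemma FwE w s t : F w (s, t) = lam ^+ 2 * t + a * w * (lam * (s + c / a) + w).
Proof. by rewrite /Fw /=; field. Qed.

(** In the units x = (s + c / a) / w and r = u / w, the gap between the two sides is a w^2 /
    lambda^2 times the gap in [arc_monotone]. *)
Lemma arc_flow w u sig p : w != 0 -> u / w <= 1 -> 0 <= sig ->
  (flow u sig p).2 - arc w (p.1 + sig * u + c / a) <=
  expR (lam * sig) * (p.2 - arc w (p.1 + c / a)).
Proof.
move=> w0 uw s0; set x := (p.1 + c / a) / w; set r := u / w.
have H := arc_monotone _ lam x r sig ln uw s0.
have Ex : (p.1 + sig * u + c / a) / w = x + r * sig by rewrite /x /r; field; rewrite ?an0 ?w0.
have E1 : p.1 = x * w - c / a by rewrite /x divfK // addrK.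
have E2 : u = r * w by rewrite /r divfK.
rewrite -subr_ge0.
suff -> : expR (lam * sig) * (p.2 - arc w (p.1 + c / a)) -
   ((flow u sig p).2 - arc w (p.1 + sig * u + c / a)) =
   a * w ^+ 2 / lam ^+ 2 * (expR (lam * (x + r * sig)) - lam * (x + r * sig) - 1
     + r * (lam * (x + r * sig) + r) -
     expR (lam * sig) * (expR (lam * x) - lam * x - 1 + r * (lam * x + r))).
  rewrite mulr_ge0 ?subr_ge0 // divr_ge0 ?sqr_ge0 // mulr_ge0 ?sqr_ge0 //; exact: ltW.
rewrite /arc Ex -/x /const_flow /Fw /= E2 E1.
by field; rewrite ?lam0 ?an0.
Qed.

(** Splitting at s = - c / a leaves one branch of [top] at a time; its control [w] is the end of
    Omega of the same sign, whence u / w <= 1. *)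
Lemma top_decays : decays (fun p => p.2 - top p.1).
Proof.
apply: (decays_split _ _ _ _ _ _ lam0 (- c / a)) => u sig p /andP[h1 h2] s0 H.
have [[e1 e2]|[e1 e2]] : (p.1 + c / a <= 0 /\ p.1 + sig * u + c / a <= 0) \/
   (0 <= p.1 + c / a /\ 0 <= p.1 + sig * u + c / a).
- by case: H => -[? ?]; [left|right]; split; lra.
- rewrite /= top_neg // top_neg //; apply: arc_flow => //.
  by rewrite -mulrNN -invrN ler_pdivrMr ?mul1r ?lerN2 // oppr_gt0.
- rewrite /= top_pos // top_pos //; apply: arc_flow => //.
  by rewrite ler_pdivrMr ?mul1r.
Qed.

Lemma Fw_flow_diff w u sig p : F w (flow u sig p) - expR (lam * sig) * F w p =
  a * (w - u) * ((w + u + lam * (p.1 + c / a)) * (1 - expR (lam * sig)) + lam * sig * u).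
Proof. by rewrite /const_flow /Fw /=; field; rewrite ?an0 ?lam0. Qed.

Lemma bottom_decays : decays (fun p => - Num.max (F wm p) (F wp p)).
Proof.
have [wm' wp'] := (wm0, wp0).
have Fcmp p : F wp p - F wm p = a * (wp - wm) * (lam * (p.1 + c / a) + wp + wm).
  by rewrite /Fw; field.
have am0 : 0 <= a * (wp - wm) by rewrite mulr_ge0 ?subr_ge0 ?ltW // (lt_trans wm0).
(* On this line F_{omega-} and F_{omega+} agree; to its left the maximum is F_{omega+}, to its right
   F_{omega-}. *)
apply: (decays_split _ _ _ _ _ _ lam0 (- c / a - (wp + wm) / lam)) => u sig p /andP[h1 h2] s0 H.
have L0 q : q <= - c / a - (wp + wm) / lam -> 0 <= lam * (q + c / a) + wp + wm.
  move=> hq; have : lam * (- c / a - (wp + wm) / lam) <= lam * q by rewrite ler_wnM2l // ltW.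
  rewrite (_ : lam * (_ - _) = - lam * (c / a) - (wp + wm)); last by field; rewrite ?lam0 ?an0.
  by lra.
have L1 q : - c / a - (wp + wm) / lam <= q -> lam * (q + c / a) + wp + wm <= 0.
  move=> hq; have : lam * q <= lam * (- c / a - (wp + wm) / lam) by rewrite ler_wnM2l // ltW.
  rewrite (_ : lam * (_ - _) = - lam * (c / a) - (wp + wm)); last by field; rewrite ?lam0 ?an0.
  by lra.
have y0 : 0 <= - (lam * sig) by rewrite oppr_ge0 mulr_le0_ge0 // ltW.
rewrite mulrN lerN2.
case: H => [[/L0 e1 /L0 e2]|[/L1 e1 /L1 e2]].
  rewrite (max_r (x := F wm p)); last by rewrite -subr_ge0 Fcmp mulr_ge0.
  rewrite le_max; apply/orP; right; rewrite -subr_ge0 Fw_flow_diff.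
  apply: mulr_ge0; first by rewrite mulr_ge0 ?subr_ge0 // ltW.
  have := one_sub_expR_ge _ (wp + lam * (p.1 + c / a)) u _ _ _ y0.
  by rewrite opprK => H; suff : u * - (lam * sig) <= (wp + lam * (p.1 + c / a) + u) * (1 - expR (lam * sig));
    [lra|apply: H; lra].
rewrite (max_l (x := F wm p)); last first.
  by rewrite -subr_le0 Fcmp mulr_ge0_le0.
rewrite le_max; apply/orP; left; rewrite -subr_ge0 Fw_flow_diff.
apply: mulr_le0; first by rewrite mulr_ge0_le0 ?subr_le0 // ltW.
have := one_sub_expR_ge _ (- (wm + lam * (p.1 + c / a))) (- u) _ _ _ y0.
by rewrite opprK => H; suff : - u * - (lam * sig) <= (- (wm + lam * (p.1 + c / a)) + - u) * (1 - expR (lam * sig));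
    [lra|apply: H; lra].
Qed.

(** * The candidate region: upper bound, closedness, invariance *)

Definition core := [set p : R * R | p.2 <= top p.1 /\ 0 <= Num.max (F wm p) (F wp p)].

Lemma core_bound D : invariant D -> approx D -> D `<=` core.
Proof.
move=> iD aD v Dv.
have ct : continuous (fun p : R * R => p.2 - top p.1).
  move=> p; apply: cvgB; first exact: cvg_snd.
  by apply: (@continuous_comp _ _ _ fst top); [exact: cvg_fst|exact: continuous_top].
have cb : continuous (fun p : R * R => - Num.max (F wm p) (F wp p)).
  move=> p; apply: cvgN.
  by apply: (@continuous_max _ _ (F wm) (F wp)); exact: continuous_Fw.
have := decays_le0 _ _ _ _ _ _ lam0 wm0 wp0 _ _ ln ct top_decays iD aD _ Dv.
have := decays_le0 _ _ _ _ _ _ lam0 wm0 wp0 _ _ ln cb bottom_decays iD aD _ Dv.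
by rewrite /= /core /= subr_le0 oppr_le0.
Qed.

Lemma closed_core : closed core.
Proof.
rewrite (_ : core = (fun p => p.2 - top p.1) @^-1` [set r | r <= 0] `&`
   (fun p => Num.max (F wm p) (F wp p)) @^-1` [set r | 0 <= r]).
  apply: closedI; apply: preimage_closed; try exact: closed_le; try exact: closed_ge.
    move=> p _; apply: cvgB; first exact: cvg_snd.
    by apply: (@continuous_comp _ _ _ fst top); [exact: cvg_fst|exact: continuous_top].
  by move=> p _; apply: (@continuous_max _ _ (F wm) (F wp)); exact: continuous_Fw.
by apply/seteqP; split=> p; rewrite /core /= subr_le0.
Qed.

(** If s + c / a >= 0, both omega- and lambda (s + c / a) + omega- are negative, so F_{omega-} >= 0;
    otherwise omega+ serves symmetrically. *)
Lemma max_Fw_ge0 s t : 0 <= t -> 0 <= Num.max (F wm (s, t)) (F wp (s, t)).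
Proof.
move=> t0; rewrite le_max !FwE.
have h0 : 0 <= lam ^+ 2 * t by rewrite mulr_ge0 ?sqr_ge0.
have [h|/ltW h] := leP 0 (s + c / a); apply/orP; [left|right]; apply: addr_ge0 => //.
  rewrite -mulrA; apply: mulr_ge0 (ltW a0) (mulr_le0 (ltW wm0) _).
  by rewrite -oppr_ge0 opprD addr_ge0 // oppr_ge0 ?mulr_le0_ge0 // ltW.
rewrite -mulrA; apply: mulr_ge0 (ltW a0) (mulr_ge0 (ltW wp0) _).
by rewrite addr_ge0 ?(ltW wp0) // mulr_le0 // ltW.
Qed.

Lemma flow_zero sig p : flow 0 sig p = (p.1, expR (lam * sig) * p.2).
Proof. by rewrite /const_flow /Fw mulr0 addr0 /=; congr pair; field. Qed.

(** The zero control contracts t to 0 at fixed s. A point with t >= 0 stays between 0 and [top]; one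
    with t < 0 moves up, which cannot lower any F_w. *)
Lemma core_invariant : invariant core.
Proof.
move=> [s t] [/= H1 H2]; exists (fun=> 0), (fun r => flow 0 r (s, t)); split.
  by apply: cst_admissible; rewrite !ltW.
split; first exact: cst_solution.
move=> tau t0; rewrite flow_zero /core /=; set E := expR _.
have E0 : 0 <= E by exact: expR_ge0.
have E1 : E <= 1 by rewrite expR_le1 mulr_le0_ge0 // ltW.
have [tp|tn] := leP 0 t.
  split; first by apply: le_trans H1; rewrite ler_piMl.
  by apply: max_Fw_ge0; rewrite mulr_ge0.
split; first by apply: le_trans (top_ge0 _); rewrite mulr_ge0_le0 // ltW.
have ht : lam ^+ 2 * t <= lam ^+ 2 * (E * t).
  by rewrite ler_wpM2l ?sqr_ge0 // ler_niMl // ltW.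
move: H2; rewrite !le_max !FwE => /orP[] h; apply/orP; [left|right]; lra.
Qed.

Lemma Cplus_top p : Cplus lam a c wm wp p <-> top p.1 < p.2.
Proof.
split=> [[tau [w [t0 [[->|->] [E H]]]]]|H].
- have E' : p.1 + c / a = tau * wm by rewrite E; field.
  by rewrite top_neg E' /arc ?mulfK // mulr_ge0_le0 // ltW.
- have E' : p.1 + c / a = tau * wp by rewrite E; field.
  by rewrite top_pos E' /arc ?mulfK // mulr_ge0 // ltW.
- have [h|/ltW h] := leP 0 (p.1 + c / a).
    exists ((p.1 + c / a) / wp), wp; split; first by rewrite divr_ge0 // ltW.
    split; first by right.
    by split; [rewrite divfK //; field|rewrite top_pos in H].
  exists ((p.1 + c / a) / wm), wm; split.
    by rewrite mulr_le0 // invr_le0 ltW.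
  split; first by left.
  by split; [rewrite divfK //; field|rewrite top_neg in H].
Qed.

Lemma coreE : core = ~` (Cplus lam a c wm wp `|` Cminus lam a c wm wp).
Proof.
apply/seteqP; split=> p.
  move=> [H1]; rewrite le_max => H2 [/Cplus_top|[/= h1 h2]].
    by rewrite ltNge H1.
  by move: H2; rewrite !leNgt h1 h2.
move=> H; split.
  by rewrite leNgt; apply/negP => h; apply: H; left; exact/Cplus_top.
rewrite leNgt gt_max; apply/negP => /andP[h1 h2]; apply: H; right; by split.
Qed.

(** The system is affine in t, so under the same controls a vertical offset is multiplied by
    e^{lambda tau}. *)
Lemma reach_translate s t d tau y : reach (s, t) tau y ->
  reach (s, t + d) tau (y.1, y.2 + expR (lam * tau) * d).
Proof.
elim=> [|{y}tau' y u sig _ IH Hu Hs]; first by rewrite mulr0 expR0 mul1r; exact: reach0.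
suff -> : ((flow u sig y).1, (flow u sig y).2 + expR (lam * (tau' + sig)) * d) =
    flow u sig (y.1, y.2 + expR (lam * tau') * d) by apply: reachS.
rewrite /const_flow /Fw /=; congr pair; rewrite (mulrDr lam tau' sig) expRD.
by field.
Qed.

(** After an extreme control has led to s = - c / a and waiting there has shrunk the height [t1],
    the controls leading from v_a to [y] are replayed; the remaining offset can only shrink. *)
Lemma reach_from_center v y e : (exists tau, reach (- c / a, 0) tau y) -> 0 < e ->
  exists2 t', (exists tau, reach v tau (y.1, t')) & `|y.2 - t'| < e.
Proof.
move=> [tau Hy] e0.
have [t1 [tau1 H1]] : exists t1 tau1, reach v tau1 (- c / a, t1).
  suff [u [sig [Hu Hs E]]] : exists u sig, [/\ wm <= u <= wp, 0 <= sig & v.1 + sig * u = - c / a].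
    by exists (flow u sig v).2, sig; rewrite -E; exact: reach_flow.
  have [h|/ltW h] := leP 0 (v.1 + c / a).
    exists wm, (- (v.1 + c / a) / wm); split.
    - by rewrite lexx ltW // (lt_trans wm0).
    - by rewrite mulr_le0 // ?oppr_le0 // invr_le0 ltW.
    - by rewrite divfK //; field.
  exists wp, (- (v.1 + c / a) / wp); split.
  - by rewrite lexx andbT ltW // (lt_trans wm0).
  - by rewrite divr_ge0 // ?oppr_ge0 // ltW.
  - by rewrite divfK //; field.
have [K K0 HK] := expR_linear_small _ lam `|t1| e ln (normr_ge0 _) e0.
have H2 : reach v (tau1 + K) (- c / a, 0 + expR (lam * K) * t1).
  have := reachS _ _ _ _ _ _ _ _ _ 0 K H1; rewrite flow_zero add0r; apply=> //.
  by rewrite !ltW.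
exists (y.2 + expR (lam * tau) * (expR (lam * K) * t1)).
  exists (tau1 + K + tau); apply: (reach_trans _ _ _ _ _ _ _ _ _ _ _ H2).
  exact: reach_translate.
rewrite opprD addrA subrr add0r normrN !normrM !(ger0_norm (expR_ge0 _)).
apply: le_lt_trans HK.
have E1 : expR (lam * tau) <= 1.
  by rewrite expR_le1 mulr_le0_ge0 ?(reach_ge0 _ _ _ _ _ _ _ _ _ Hy) // ltW.
apply: (@le_trans _ _ (expR (lam * K) * `|t1|)).
  by rewrite ler_piMl // mulr_ge0 ?expR_ge0.
by rewrite ler_wpM2l ?expR_ge0 // ler_peMr // lerDl.
Qed.

Lemma reach_top s : exists tau, reach (- c / a, 0) tau (s, top s).
Proof.
have H w : w != 0 -> wm <= w <= wp -> 0 <= (s + c / a) / w ->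
    exists tau, reach (- c / a, 0) tau (s, arc w (s + c / a)).
  move=> w0 Hw h; exists ((s + c / a) / w).
  suff -> : (s, arc w (s + c / a)) = flow w ((s + c / a) / w) (- c / a, 0) by exact: reach_flow.
  rewrite /const_flow /arc /Fw /=; congr pair; first by rewrite divfK //; field.
  by field; rewrite ?lam0 ?an0 ?w0.
have [h|/ltW h] := leP 0 (s + c / a).
  rewrite top_pos //; apply: H => //; last by rewrite divr_ge0 // ltW.
  by rewrite lexx andbT ltW // (lt_trans wm0).
rewrite top_neg //; apply: H => //; last by rewrite mulr_le0 // invr_le0 ltW.
by rewrite lexx ltW // (lt_trans wm0).
Qed.

(* Value of F w at the point of abscissa s reached by leaving the arc of top at
   abscissa s - K w and applying w during time K. *)
Definition sweep w s K := expR (lam * K) * F w (s - K * w, top (s - K * w)).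

Lemma reach_sweep w s t K : wm <= w <= wp -> 0 <= K -> F w (s, t) = sweep w s K ->
  exists tau, reach (- c / a, 0) tau (s, t).
Proof.
move=> Hw K0 E; have [tau H] := reach_top (s - K * w); exists (tau + K).
by rewrite (flowP _ lam a c lam0 w K _ (s, t) _ E) /= ?subrK //; exact: reachS.
Qed.

Lemma continuous_sweep w s : continuous (sweep w s).
Proof.
have cs : continuous (fun K : R => s - K * w).
  by move=> K; apply: cvgB; [exact: cvg_cst|exact: mulrr_continuous].
move=> K; apply: cvgM.
  apply: (@continuous_comp _ _ _ (fun K : R => lam * K)); last exact: continuous_expR.
  exact: mulrl_continuous.
apply: (@continuous_comp _ _ _ (fun K : R => (s - K * w, top (s - K * w))) (F w)); last exact: continuous_Fw.
have ct := continuous_comp (cs K) (continuous_top (s - K * w)).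
exact: (cvg_pair (cs K) ct).
Qed.

(** Since [arc] grows at most linearly, so does F_w along the graph of [top]; the factor e^{lambda
    K} in [sweep] then wins. *)
Lemma Fw_top_bound w s : wm <= w <= wp ->
  `|F w (s, top s)| <= a * (wp - wm) * (- lam * `|s + c / a| *+ 2 + (wp - wm)).
Proof.
have [wm' wp'] := (wm0, wp0).
move=> /andP[h1 h2]; rewrite FwE; set S := s + c / a; set m := wp - wm.
have m0 : 0 <= m by rewrite /m; lra.
have S0 : 0 <= `|S| by exact: normr_ge0.
have ht : lam ^+ 2 * top s <= a * m * (- lam * `|S|).
  have h : top s <= a * m * `|S| / - lam.
    have [h|/ltW h] := leP 0 S.
      rewrite top_pos //; apply: (le_trans (arc_le _ _ wpn0 _)); first by rewrite divr_ge0 // ltW.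
      rewrite ler_pM2r ?invr_gt0 ?oppr_gt0 // -/S ger0_norm // ler_wpM2r //.
      by rewrite ler_pM2l // /m; lra.
    rewrite top_neg //; apply: (le_trans (arc_le _ _ wmn0 _)).
      by rewrite mulr_le0 // invr_le0 ltW.
    rewrite ler_pM2r ?invr_gt0 ?oppr_gt0 // -/S ler0_norm // mulrN -mulNr ler_wnM2r //.
    by rewrite -mulrN ler_pM2l // /m; lra.
  apply: (le_trans (ler_wpM2l (sqr_ge0 lam) h)).
  by rewrite le_eqVlt; apply/orP; left; apply/eqP; field; rewrite ?oppr_eq0.
have aw : `|w| <= m by rewrite ler_norml /m; apply/andP; split; lra.
apply: (le_trans (ler_normD _ _)).
rewrite (ger0_norm (mulr_ge0 (sqr_ge0 lam) (top_ge0 s))).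
have h3 : `|a * w * (lam * S + w)| <= a * m * (- lam * `|S| + m).
  rewrite !normrM (ger0_norm (ltW a0)) -!mulrA ler_pM2l // ler_pM //.
  apply: (le_trans (ler_normD _ _)); rewrite normrM (ltr0_norm ln).
  by rewrite lerD2l.
by apply: (le_trans (lerD ht h3)); rewrite le_eqVlt; apply/orP; left; apply/eqP; ring.
Qed.

Lemma sweep_small w s e : wm <= w <= wp -> 0 < e ->
  exists2 K, 0 <= K & `|sweep w s K| < e.
Proof.
have [wm' wp'] := (wm0, wp0).
move=> Hw e0; set m := wp - wm; have m0 : 0 <= m by rewrite /m; lra.
(* Chosen so that |s - K w + c / a| <= Q (1 + K); then [M * (1 + K)] dominates [Fw_top_bound] at s -
   K w. *)
pose Q := `|s + c / a| + m; have Q0 : 0 <= Q by rewrite addr_ge0.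
pose M := a * m * (- lam * Q *+ 2 + m).
have l0 : 0 <= - lam by rewrite oppr_ge0 ltW.
have lQ : 0 <= - lam * Q *+ 2 by rewrite mulrn_wge0 // mulr_ge0.
have am0 : 0 <= a * m by rewrite mulr_ge0 // ltW.
have M0 : 0 <= M by rewrite mulr_ge0 // addr_ge0.
have [K K0 HK] := expR_linear_small _ lam M e ln M0 e0; exists K => //.
apply: le_lt_trans HK; rewrite normrM (ger0_norm (expR_ge0 _)) ler_wpM2l ?expR_ge0 //.
apply: (le_trans (Fw_top_bound _ _ Hw)); rewrite -/m /M -[leRHS]mulrA ler_wpM2l //.
have hS : `|s - K * w + c / a| <= Q * (1 + K).
  rewrite (_ : _ + _ = (s + c / a) + K * - w); last by ring.
  apply: (le_trans (ler_normD _ _)); rewrite normrM normrN (ger0_norm K0).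
  have aw : `|w| <= m by case/andP: Hw => *; rewrite ler_norml /m; apply/andP; split; lra.
  have q1 : K * `|w| <= K * m by rewrite ler_wpM2l.
  have q2 : 0 <= K * `|s + c / a| by rewrite mulr_ge0.
  by rewrite /Q; lra.
have h1 : - lam * `|s - K * w + c / a| <= - lam * (Q * (1 + K)) by rewrite ler_wpM2l.
apply: (@le_trans _ _ ((- lam * (Q * (1 + K))) *+ 2 + m * (1 + K))).
  by apply: lerD; [rewrite lerMn2r h1 orbT|rewrite ler_peMr // lerDl].
by rewrite le_eqVlt; apply/orP; left; apply/eqP; ring.
Qed.

(** Some end w of Omega has F_w >= 0 at the point. A positive value is attained exactly, by the
    intermediate value theorem between K = 0, where [top] dominates t, and a large K. *)
Lemma core_reach_center s t e : core (s, t) -> 0 < e ->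
  exists2 t', (exists tau, reach (- c / a, 0) tau (s, t')) & `|t - t'| < e.
Proof.
move=> [/= H1 H2] e0.
have l2 : 0 < lam ^+ 2 by rewrite exprn_even_gt0.
have [w [Hw Fw0]] : exists w, wm <= w <= wp /\ 0 <= F w (s, t).
  move: H2; rewrite le_max => /orP[h|h]; [exists wm|exists wp]; split=> //.
    by rewrite lexx ltW // (lt_trans wm0).
  by rewrite lexx andbT ltW // (lt_trans wm0).
(* The value 0 is only approached: a small value of [sweep] is taken instead, and the slope lambda^2
   of F_w in t converts it into a height error below [e]. *)
have [F0|Fn0] := eqVneq (F w (s, t)) 0.
  have [K K0 HK] := sweep_small w s (lam ^+ 2 * e) Hw (mulr_gt0 l2 e0).
  pose t' := t + sweep w s K / lam ^+ 2.
  have Et : F w (s, t') = sweep w s K.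
    have : F w (s, t') = F w (s, t) + sweep w s K by rewrite !FwE /t'; field; rewrite ?an0.
    by rewrite F0 add0r.
  exists t'; first exact: reach_sweep Et.
  rewrite /t' opprD addrA subrr add0r normrN normrM normfV (gtr0_norm l2).
  by rewrite ltr_pdivrMr // mulrC.
have Fp : 0 < F w (s, t) by rewrite lt_neqAle eq_sym Fn0.
have [K K0 HK] := sweep_small w s _ Hw Fp.
have Hs0 : F w (s, t) <= sweep w s 0.
  by rewrite /sweep mulr0 expR0 mul1r mul0r subr0 !FwE lerD2r ler_pM2l.
have HK' : sweep w s K <= F w (s, t) by apply: ltW; apply: le_lt_trans HK; exact: ler_norm.
have [|K' K'0 E] := IVT (v := F w (s, t)) K0 (continuous_subspaceT (continuous_sweep w s)).
  by rewrite ge_min le_max Hs0 HK' orbT.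
exists t; last by rewrite subrr normr0.
apply: (reach_sweep w s t K' Hw) => //.
by move: K'0; rewrite in_itv /= => /andP[].
Qed.

Lemma core_approx : approx core.
Proof.
move=> v _ [s t] Hc; apply: closure_vertical => e e0.
(* One half for approaching the target from v_a, the other for starting at [v] instead of v_a. *)
have e2 : 0 < e / 2 by rewrite divr_gt0.
have [t1 H1 d1] := core_reach_center _ _ _ Hc e2.
have [t2 H2 d2] := reach_from_center v _ _ H1 e2.
exists t2; first by apply/orbit_plusP.
have := ler_normD (t - t1) (t1 - t2); rewrite addrA subrK /= in d2 * => h.
by rewrite (splitr e); apply: (le_lt_trans h); rewrite ltrD.
Qed.

Lemma control_set_pos :
  control_set lam a c wm wp core /\ forall D, control_set lam a c wm wp D -> D = core.
Proof.
apply: control_set_unique.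
- by exists (0, 0); split; [exact: top_ge0|exact: max_Fw_ge0].
- exact: core_invariant.
- exact: core_approx.
- exact: core_bound.
Qed.

End CasePos.

(** * The two cases combined, with k = - c / lambda when a = 0 *)

Theorem theorem1 (R : realType) (lam a c wm wp : R) :
  lam != 0 -> 0 <= a -> a ^+ 2 + c ^+ 2 != 0 -> wm < 0 -> 0 < wp ->
  (a = 0 ->
    exists C : set (R * R), control_set lam a c wm wp C /\
      (forall D, control_set lam a c wm wp D -> D = C) /\
      closure C = [set p | exists w, wm <= w <= wp /\ p.2 = - (c / lam) * w] /\
      (lam < 0 -> closed C) /\ (0 < lam -> open C)) /\
  (0 < a -> lam < 0 ->
    exists C : set (R * R), control_set lam a c wm wp C /\
      (forall D, control_set lam a c wm wp D -> D = C) /\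
      closed C /\
      C = ~` (Cplus lam a c wm wp `|` Cminus lam a c wm wp)).
Proof.
move=> lam0 _ ac0 wm0 wp0; split=> [a0|a0 ln].
  have c0 : c != 0 by apply: contraNneq ac0 => ->; rewrite a0 !expr0n addr0.
  pose k := - (c / lam); have k0 : k != 0 by rewrite oppr_eq0 mulf_neq0 // invr_eq0.
  have Ec : c = - (k * lam) by rewrite /k; field.
  have [C [C1 [C2 [C3 C4]]]] := control_set_zero _ lam k wm wp lam0 k0 wm0 wp0.
  exists C; rewrite a0 -/k Ec; split=> //; split=> //; split=> //.
  rewrite C3; apply/seteqP; split=> p /=.
    by move=> Hp; exists (p.2 / k); split=> //; rewrite mulrC divfK.
  by move=> [w [Hw E]]; rewrite /closed_strip /= E mulrAC divff ?mul1r.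
have [h1 h2] := control_set_pos _ lam a c wm wp ln a0 wm0 wp0.
exists (core R lam a c wm wp); split=> //; split=> //; split.
  exact: closed_core.
exact: coreE.
Qed.
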